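(* Any nilpotent complex symplectic Lie algebra $(\mathfrak g,J,\omega)$ with Abelian $J$ may be obtained by iterated complex symplectic oxidation from the trivial $0$-dimensional complex symplectic Lie algebra.
   Context: A complex symplectic Lie algebra $(\mathfrak g,J,\omega)$ is a real Lie algebra with $J\in\operatorname{End}(\mathfrak g)$, $J^2=-\mathrm{Id}$, vanishing Nijenhuis tensor $N_J(X,Y)=[X,Y]+J[JX,Y]+J[X,JY]-[JX,JY]$, and a closed non-degenerate $2$-form $\omega$ with $\omega(JX,Y)=\omega(X,JY)$; its dimension is a multiple of $4$. $J$ is Abelian if $[X,Y]=[JX,JY]$ for all $X,Y$. Isomorphisms of complex symplectic Lie algebras are Lie algebra isomorphisms intertwining the complex structures and pulling back one symplectic form to the other. Complex symplectic oxidation: $(\mathfrak g,J,\omega)$ of dimension $4n$ is the complex symplectic oxidation of $(\bar{\mathfrak g},\bar J,\bar\omega)$ of dimension $4n-4$ if (up to isomorphism) $\mathfrak g=V\oplus\bar{\mathfrak g}\oplus V^*$ as vector spaces for a two-dimensional real vector space $V$, the only non-zero Lie brackets (up to anti-symmetry) being $$[(v,0,0),(w,0,0)]=(0,\nu(v,w),\tau(v,w)),\quad[(v,0,0),(0,X,0)]=(0,f(v,X),g(v,X)),\quad[(0,X,0),(0,Y,0)]=(0,[X,Y]_{\bar{\mathfrak g}},\beta(X,Y))$$ for $v,w\in V$, $X,Y\in\bar{\mathfrak g}$, with $\nu\in\Lambda^2V^*\otimes\bar{\mathfrak g}$, $\tau\in\Lambda^2V^*\otimes V^*$, $f\in V^*\otimes\operatorname{End}(\bar{\mathfrak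 g})$, $g\in V^*\otimes\bar{\mathfrak g}^*\otimes V^*$, $\beta\in\Lambda^2\bar{\mathfrak g}^*\otimes V^*$, and $V$ has an almost complex structure $I$ such that $J=I+\bar J+I^*$ (with $(I^*\alpha)(v)=\alpha(Iv)$) and $$\omega\big((v,X,\alpha),(w,Y,\gamma)\big)=\alpha(w)-\gamma(v)+\bar\omega(X,Y).$$ ''Obtained by iterated complex symplectic oxidation from the trivial Lie algebra'' means that there is a finite sequence of complex symplectic Lie algebras starting with the $0$-dimensional one and ending with $(\mathfrak g,J,\omega)$, each being the complex symplectic oxidation of the preceding one. *)

(* Defs.v *)
From HB Require Import structures.
From mathcomp Require Import all_boot all_order all_algebra.
From mathcomp Require Import reals.

Set Implicit Arguments.
Unset Strict Implicit.
Unset Printing Implicit Defensive.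

Import Order.TTheory GRing.Theory Num.Theory.
Local Open Scope ring_scope.

(* No axiom is imposed here, so that the structure on the vector space        *)
(* V + gbar + V^* can be written down for arbitrary oxidation data; the       *)
(* axioms are in [is_complex_symplectic]. vectType is finite-dimensional.     *)
Record cs_data (R : realType) := CSData {
  cs_space :> vectType R;
  lie : cs_space -> cs_space -> cs_space;
  cpx : cs_space -> cs_space;
  sympl : cs_space -> cs_space -> R
}.

Arguments lie {R c} x y.
Arguments cpx {R c} x.
Arguments sympl {R c} x y.

Section Structures.
Variable R : realType.
Implicit Types g h : cs_data R.

Definition is_lie_bracket g : Prop :=
  [/\ forall x : g, linear (lie x),
      forall y : g, linear (fun x : g => lie x y),
      forall x : g, lie x x = 0
    & forall x y z : g,
        lie x (lie y z) + lie y (lie z x) + lie z (lie x y) = 0].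

Definition nijenhuis g (x y : g) : g :=
  lie x y + cpx (lie (cpx x) y) + cpx (lie x (cpx y)) - lie (cpx x) (cpx y).

Definition is_complex_structure g : Prop :=
  [/\ linear (@cpx R g),
      forall x : g, cpx (cpx x) = - x
    & forall x y : g, nijenhuis x y = 0].

(* The fourth clause is the vanishing of the Chevalley-Eilenberg differential *)
(* (up to an overall sign).                                                   *)
Definition is_symplectic_form g : Prop :=
  [/\ forall x : g, scalar (sympl x),
      forall y : g, scalar (fun x : g => sympl x y),
      forall x : g, sympl x x = 0,
      forall x y z : g,
        sympl (lie x y) z + sympl (lie y z) x + sympl (lie z x) y = 0
    & forall x : g, (forall y : g, sympl x y = 0) -> x = 0].

Definition is_complex_symplectic g : Prop :=
  [/\ is_lie_bracket g, is_complex_structure g, is_symplectic_form g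
    & forall x y : g, sympl (cpx x) y = sympl x (cpx y)].

Definition abelian_cpx g : Prop :=
  forall x y : g, lie x y = lie (cpx x) (cpx y).

(* For a bilinear bracket this is the span of all brackets [x, y] with x in U *)
(* and y in W (see [lie_prod_subvP]).                                         *)
Definition lie_prod g (U W : {vspace g}) : {vspace g} :=
  <<[seq lie x y | x <- vbasis U, y <- vbasis W]>>%VS.

Definition lower_central g (k : nat) : {vspace g} :=
  iter k (lie_prod fullv) fullv.

Definition nilpotent_lie g : Prop := exists k : nat, lower_central g k = 0%VS.

Definition cs_isomorphic g h : Prop :=
  exists phi : 'Hom(g, h),
    [/\ bijective phi,
        forall x y : g, phi (lie x y) = lie (phi x) (phi y),
        forall x : g, phi (cpx x) = cpx (phi x)
      & forall x y : g, sympl x y = sympl (phi x) (phi y)].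

End Structures.

Record cs_lie (R : realType) := CSLie {
  cs_lie_data :> cs_data R;
  cs_lieP : is_complex_symplectic cs_lie_data
}.

Lemma lie_prod_subvP (R : realType) (g : cs_data R) (U W Z : {vspace g}) :
  is_lie_bracket g ->
  reflect (forall x y : g, x \in U -> y \in W -> lie x y \in Z)
          (lie_prod U W <= Z)%VS.
Proof.
move=> [linr linl _ _].
have suml I r (P : pred I) (F : I -> g) y :
    lie (\sum_(i <- r | P i) F i) y = \sum_(i <- r | P i) lie (F i) y.
  pose ly := GRing.isLinear.Build _ _ _ _ _ (linl y).
  exact: (linear_sum (HB.pack (fun x : g => lie x y) ly : {linear g -> g})).
have sumr I r (P : pred I) (F : I -> g) x :
    lie x (\sum_(i <- r | P i) F i) = \sum_(i <- r | P i) lie x (F i).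
  pose lx := GRing.isLinear.Build _ _ _ _ _ (linr x).
  exact: (linear_sum (HB.pack (lie x) lx : {linear g -> g})).
have scalel a (x y : g) : lie (a *: x) y = a *: lie x y.
  pose ly := GRing.isLinear.Build _ _ _ _ _ (linl y).
  exact: (linearZ_LR (HB.pack (fun x : g => lie x y) ly : {linear g -> g})).
have scaler a (x y : g) : lie x (a *: y) = a *: lie x y.
  pose lx := GRing.isLinear.Build _ _ _ _ _ (linr x).
  exact: (linearZ_LR (HB.pack (lie x) lx : {linear g -> g})).
apply: (iffP span_subvP) => [sub x y Ux Wy | sub z].
  rewrite (coord_vbasis Ux) (coord_vbasis Wy) suml; apply: memv_suml => i _.
  rewrite sumr; apply: memv_suml => j _; rewrite scalel scaler.
  apply/memvZ/memvZ/sub/allpairsP; exists ((vbasis U)`_i, (vbasis W)`_j).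
  by split => //=; apply: mem_nth; rewrite size_tuple.
by case/allpairsP=> -[x y] [/= Ux Wy ->]; apply: sub; apply: vbasis_mem.
Qed.

(* V^* is 'Hom(V, R^o), and V + gbar + V^* is the product of vector spaces.   *)
Section Oxidation.
Variables (R : realType) (V : vectType R) (gbar : cs_data R).

Definition alternating (U W : vectType R) (b : 'Hom(U, 'Hom(U, W))) : Prop :=
  forall u : U, b u u = 0.

Definition oxidation_space : vectType R := (V * gbar * 'Hom(V, R^o))%type.

Variables (I : 'End(V))
  (nu : 'Hom(V, 'Hom(V, gbar))) (tau : 'Hom(V, 'Hom(V, 'Hom(V, R^o))))
  (f : 'Hom(V, 'End(gbar))) (gg : 'Hom(V, 'Hom(gbar, 'Hom(V, R^o))))
  (beta : 'Hom(gbar, 'Hom(gbar, 'Hom(V, R^o)))).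

(* The bilinear antisymmetric extension of the brackets [V, V], [V, gbar] and *)
(* [gbar, gbar]; V^* is central.                                              *)
Definition oxidation_lie (a b : oxidation_space) : oxidation_space :=
  let: (v, x, _) := a in let: (w, y, _) := b in
  (0, nu v w + f v y - f w x + lie x y,
   tau v w + gg v y - gg w x + beta x y).

Definition oxidation_cpx (a : oxidation_space) : oxidation_space :=
  let: (v, x, alpha) := a in (I v, cpx x, (alpha \o I)%VF).

Definition oxidation_sympl (a b : oxidation_space) : R :=
  let: (v, x, alpha) := a in let: (w, y, gamma) := b in
  alpha w - gamma v + sympl x y.

Definition oxidation_data : cs_data R :=
  CSData oxidation_lie oxidation_cpx oxidation_sympl.

End Oxidation.

Definition is_oxidation (R : realType) (g gbar : cs_lie R) : Prop :=
  exists (V : vectType R) (I : 'End(V))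
    (nu : 'Hom(V, 'Hom(V, gbar))) (tau : 'Hom(V, 'Hom(V, 'Hom(V, R^o))))
    (f : 'Hom(V, 'End(gbar))) (gg : 'Hom(V, 'Hom(gbar, 'Hom(V, R^o))))
    (beta : 'Hom(gbar, 'Hom(gbar, 'Hom(V, R^o)))),
    [/\ \dim {:V} = 2%N,
        forall v : V, I (I v) = - v,
        [/\ alternating nu, alternating tau & alternating beta]
      & cs_isomorphic (oxidation_data I nu tau f gg beta) g].

Definition iterated_oxidation_from_trivial (R : realType) (g : cs_lie R) : Prop :=
  exists (m : nat) (s : nat -> cs_lie R),
    [/\ \dim {:s 0%N} = 0%N,
        forall i : nat, (i < m)%N -> is_oxidation (s i.+1) (s i)
      & s m = g].

(* Main.v *)
Require Import Defs.
From HB Require Import structures.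
From mathcomp Require Import all_boot all_order all_algebra.
From mathcomp Require Import reals boolp.
From mathcomp Require Import ring.

Set Implicit Arguments.
Unset Strict Implicit.
Unset Printing Implicit Defensive.

Import Order.TTheory GRing.Theory Num.Theory.
Local Open Scope ring_scope.

(** The theorem is an induction on dimension, run on symplectic reduction by a
    central complex line.

    If [g] is non-zero and nilpotent, the last non-zero term of its lower
    central series is central, so there is a central [z != 0]
    ([nilpotent_center]).  Since [J] is Abelian, [[Jz, x] = - [z, Jx]], hence
    the whole complex line [W = <z, Jz>] is central ([abelian_central_cpx]).
    Closedness of [omega] then gives [omega([x, y], w) = 0] for [w] in [W]:
    all brackets lie in the symplectic orthogonal of [W] ([coordV_lie]), and so
    this orthogonal is an ideal containing [[g, g]].

    A complex line is automatically isotropic, because the [omega]-symmetry of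
    [J] forces [omega(x, Jx) = 0] ([sympl_cpxx]).  Hence any [u] with
    [omega(z, u) != 0] spans together with [Ju] an isotropic complex line [V]
    dual to [W], and [u] can be normalised by [omega(z, u) = 1] and
    [omega(z, Ju) = 0] ([exists_dual_vector]).  Then
    [g = V + core + W] with [core] the orthogonal of [V + W], and [omega]
    identifies [W] with the dual of [V].

    The projection of the bracket to [core] makes it the reduction of the
    orthogonal of [W] modulo [W].  It is again complex symplectic
    ([reductionP]) with Abelian complex structure ([reduction_abelian]),
    nilpotent ([reduction_nilpotent]) and smaller ([reduction_dim]).  Reading
    off the [core]- and [W]-components of the brackets of [g] gives the tensors
    exhibiting [g] as an oxidation of it ([reduction_is_oxidation]): as [W] is
    central and no bracket has a [V]-component, [g] has no brackets other than
    those of an oxidation. *)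

(** * Linear and bilinear functions as homomorphisms *)

Definition hom_of (R : realType) (U W : vectType R) (h : U -> W)
    (h_lin : linear h) : 'Hom(U, W) :=
  linfun
    (HB.pack h (GRing.isLinear.Build R U W *:%R h h_lin) : {linear U -> W}).

Lemma hom_ofE (R : realType) (U W : vectType R) (h : U -> W)
  (h_lin : linear h) x : hom_of h_lin x = h x.
Proof. by rewrite lfunE. Qed.

Section BihomOf.
Variables (R : realType) (U V W : vectType R) (b : U -> V -> W).
Hypothesis b_linl : forall y, linear (b^~ y).
Hypothesis b_linr : forall x, linear (b x).

Let b_lin : linear (fun x => hom_of (b_linr x)).
Proof.
by move=> c x y; apply/lfunP=> z; rewrite add_lfunE scale_lfunE !hom_ofE b_linl.
Qed.

Definition bihom_of : 'Hom(U, 'Hom(V, W)) := hom_of b_lin.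

Lemma bihom_ofE x y : bihom_of x y = b x y.
Proof. by rewrite !hom_ofE. Qed.

End BihomOf.

(** * Complex symplectic Lie algebras *)

Section CsLie.
Variables (R : realType) (g : cs_lie R).
Implicit Types x y z : g.

Fact lie_bilinear : bilinear_for *:%R *:%R (@lie R g).
Proof.
case: (cs_lieP g) => -[linr linl _ _] _ _ _.
by split=> x; [apply: linl|apply: linr].
Qed.

HB.instance Definition _ :=
  bilinear_isBilinear.Build R g g g *:%R *:%R (@lie R g) lie_bilinear.

Fact sympl_bilinear : bilinear_for *%R *%R (@sympl R g).
Proof.
case: (cs_lieP g) => _ _ [linr linl _ _ _] _.
by split=> x; [apply: linl|apply: linr].
Qed.

HB.instance Definition _ :=
  bilinear_isBilinear.Build R g g R *%R *%R (@sympl R g) sympl_bilinear.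

Fact cpx_linear : linear (@cpx R g).
Proof. by case: (cs_lieP g) => _ []. Qed.

HB.instance Definition _ :=
  GRing.isLinear.Build R g g *:%R (@cpx R g) cpx_linear.

Lemma lie_bracket : is_lie_bracket g. Proof. by case: (cs_lieP g). Qed.

Lemma liexx x : lie x x = 0. Proof. by case: lie_bracket. Qed.

Lemma lieC x y : lie x y = - lie y x.
Proof.
apply/eqP; rewrite -addr_eq0; apply/eqP.
by have := liexx (x + y); rewrite linearDl !linearDr /= !liexx add0r addr0.
Qed.

Lemma jacobi x y z : lie x (lie y z) + lie y (lie z x) + lie z (lie x y) = 0.
Proof. by case: lie_bracket. Qed.

Lemma cpxK x : cpx (cpx x) = - x.
Proof. by case: (cs_lieP g) => _ []. Qed.

Lemma symplxx x : sympl x x = 0.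
Proof. by case: (cs_lieP g) => _ _ []. Qed.

Lemma symplC x y : sympl x y = - sympl y x.
Proof.
apply/eqP; rewrite -addr_eq0; apply/eqP.
by have := symplxx (x + y); rewrite linearDl !linearDr /= !symplxx add0r addr0.
Qed.

Lemma sympl_closed x y z :
  sympl (lie x y) z + sympl (lie y z) x + sympl (lie z x) y = 0.
Proof. by case: (cs_lieP g) => _ _ []. Qed.

Lemma sympl_nondeg x : (forall y, sympl x y = 0) -> x = 0.
Proof. by case: (cs_lieP g) => _ _ [_ _ _ _ nd] _; apply: nd. Qed.

Lemma sympl_cpxl x y : sympl (cpx x) y = sympl x (cpx y).
Proof. by case: (cs_lieP g). Qed.

(** Complex lines are isotropic: moving [J] across [sympl] keeps the sign, while
    exchanging the arguments changes it. *)
Lemma sympl_cpxx x : sympl x (cpx x) = 0.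
Proof.
have : sympl x (cpx x) *+ 2 = 0 by rewrite mulr2n {1}symplC sympl_cpxl addNr.
by move/eqP; rewrite mulrn_eq0 => /eqP.
Qed.

Lemma lie_lower_central k x y :
  y \in lower_central g k -> lie x y \in lower_central g k.+1.
Proof.
move=> y_k; have := subvv (lower_central g k.+1).
by move/(lie_prod_subvP _ _ _ lie_bracket); apply=> //; exact: memvf.
Qed.

(** For an Abelian complex structure the centre is a complex subspace. *)
Lemma abelian_central_cpx z :
  abelian_cpx g -> (forall x, lie z x = 0) -> forall x, lie (cpx z) x = 0.
Proof.
by move=> ab zc x; rewrite ab cpxK linearNl /= zc oppr0.
Qed.

(** The last non-zero term of the lower central series is central. *)
Lemma nilpotent_center :
  nilpotent_lie g -> \dim {:g} != 0%N ->
  exists2 z : g, z != 0 & forall x, lie z x = 0.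
Proof.
move=> g_nil g_neq0.
have ex : exists k, lower_central g k == 0%VS.
  by case: g_nil => k /eqP; exists k.
case: (ex_minnP ex) => -[|k] /eqP k0 k_min.
  by move: g_neq0; rewrite [fullv]k0 dimv0.
have nz : lower_central g k != 0%VS.
  by apply/negP=> /k_min; rewrite ltnn.
exists (vpick (lower_central g k)); first by rewrite vpick0.
move=> x; rewrite lieC.
have := lie_lower_central x (memv_pick (lower_central g k)).
by rewrite k0 memv0 => /eqP->; rewrite oppr0.
Qed.

(** The functional [x |-> omega(z, x) - i omega(z, Jx)] is linear over the
    complex numbers, with [J] acting as [i]; so a vector at which it does not
    vanish has a complex multiple at which it takes the value [1]. *)
Lemma exists_dual_vector z : z != 0 ->
  exists u, sympl z u = 1 /\ sympl z (cpx u) = 0.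
Proof.
move=> z0.
have [y] : exists y, sympl z y != 0.
  apply: contrapT => /forallNP h; case/eqP: z0; apply: sympl_nondeg => y.
  by apply/eqP/negPn/negP/h.
set a := sympl z y => a0; pose b := sympl z (cpx y); pose n := a ^+ 2 + b ^+ 2.
have n0 : n != 0 by rewrite paddr_eq0 ?sqr_ge0 // negb_and !expf_eq0 /= a0.
(* The coefficients are the real and imaginary parts of [1 / (a - i b)]. *)
exists ((a / n) *: y + (b / n) *: cpx y).
rewrite linearD !linearZ /= cpxK !linearDr /= !linearZr_LR /= linearNr /=.
rewrite -/a -/b.
by split; rewrite /n; field.
Qed.

(** An almost complex structure that is Abelian is integrable: the four terms
    cancel in pairs. *)
Lemma abelian_nijenhuis x y : abelian_cpx g -> nijenhuis x y = 0.
Proof.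
move=> ab; rewrite /nijenhuis -ab [lie x (cpx y)]ab cpxK linearNr /= linearN /=.
by rewrite addrK subrr.
Qed.

(** All the tensors of the oxidation arise as a component [p] of the bracket
    restricted to a pair of summands included by [h] and [k]. *)
Section LieHom.
Variables (U V W : vectType R).
Variables (h : 'Hom(U, g)) (k : 'Hom(V, g)) (p : 'Hom(g, W)).

Let lie_homl v : linear (fun t => p (lie (h t) (k v))).
Proof. by move=> c s t; rewrite linearP linearPl linearP. Qed.

Let lie_homr t : linear (fun v => p (lie (h t) (k v))).
Proof. by move=> c v w; rewrite linearP linearPr linearP. Qed.

Definition lie_hom : 'Hom(U, 'Hom(V, W)) := bihom_of lie_homl lie_homr.

Lemma lie_homE t v : lie_hom t v = p (lie (h t) (k v)).
Proof. exact: bihom_ofE. Qed.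

End LieHom.

End CsLie.

(** * The splitting defined by a central vector and a dual vector *)

Section Reduction.
Variables (R : realType) (g : cs_lie R) (z u : g).
Hypotheses (abelian_g : abelian_cpx g) (z_central : forall x, lie z x = 0).
Hypotheses (zu1 : sympl z u = 1) (zJu0 : sympl z (cpx u) = 0).
Implicit Types x y : g.

(** The summand [V] of the oxidation, with [embV] below sending the standard
    basis to [u, Ju]; [rot] is the almost complex structure this induces. *)
Definition plane : vectType R := (R^o * R^o)%type.
Implicit Types v w : plane.
Implicit Types a : 'Hom(plane, R^o).

Fact rot_linear : linear (fun v : plane => (- v.2, v.1) : plane).
Proof. by move=> c v w; congr pair; rewrite /= opprD scalerN. Qed.
Definition rot : 'End(plane) := hom_of rot_linear.

Fact embV_linear : linear (fun v : plane => v.1 *: u + v.2 *: cpx u).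
Proof. by move=> c v w; rewrite /= !scalerDl scalerDr !scalerA addrACA. Qed.
Definition embV : 'Hom(plane, g) := hom_of embV_linear.

Fact embD_linear :
  linear (fun a : 'Hom(plane, R^o) => a (1, 0) *: z - a (0, 1) *: cpx z).
Proof.
move=> c a b; rewrite !add_lfunE !scale_lfunE !scalerDl scalerBr !scalerA opprD.
by rewrite addrACA.
Qed.
(** The central summand, as the dual of [plane].  The sign is forced by
    [omega(Jz, Ju) = omega(z, JJu) = - omega(z, u)]: with it, [embD a] pairs
    with [embV v] to [a v]. *)
Definition embD : 'Hom('Hom(plane, R^o), g) := hom_of embD_linear.

Fact coordV_linear : linear (fun x => (sympl z x, - sympl z (cpx x)) : plane).
Proof.
by move=> c x y; congr pair; rewrite /= ?linearP linearPr //= opprD -mulrN.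
Qed.
(** The component along [embV]; its kernel is the symplectic orthogonal of
    the central line [<z, Jz>], by [omega(z, Jx) = omega(Jz, x)]. *)
Definition coordV : 'Hom(g, plane) := hom_of coordV_linear.

Fact coordD_linl (v : plane) : linear (fun x => sympl x (embV v) : R^o).
Proof. by move=> c x y; rewrite linearPl. Qed.
Fact coordD_linr x : linear (fun v : plane => sympl x (embV v) : R^o).
Proof. by move=> c v w; rewrite linearP linearPr. Qed.
(** The component along [embD]; its kernel is the symplectic orthogonal of
    [<u, Ju>]. *)
Definition coordD : 'Hom(g, 'Hom(plane, R^o)) :=
  bihom_of coordD_linl coordD_linr.

Lemma coordDE x v : coordD x v = sympl x (embV v).
Proof. exact: bihom_ofE. Qed.

Lemma sympl_embD a x : sympl (embD a) x = a (coordV x).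
Proof.
rewrite !hom_ofE linearBl !linearZl_LR /= sympl_cpxl.
set s := sympl z x; set t := sympl z _.
have -> : (s, - t) = s *: (1, 0) - t *: (0, 1) :> plane.
  by congr pair; rewrite /= !scaler0 ?subr0 ?sub0r [_ *: _]mulr1.
by rewrite linearB !linearZ /= scalerN; congr (_ - _); exact: mulrC.
Qed.

Lemma cpx_embV v : cpx (embV v) = embV (rot v).
Proof. by rewrite !hom_ofE linearD !linearZ /= cpxK scalerN scaleNr addrC. Qed.

Lemma cpx_embD a : cpx (embD a) = embD (a \o rot)%VF.
Proof.
rewrite ![embD _]hom_ofE linearB !linearZ /= cpxK !lfunE /= !hom_ofE /=.
have -> : (- 0, 1) = (0, 1) :> plane by rewrite oppr0.
have -> : (- 1, 0) = - (1, 0) :> plane by congr pair; rewrite /= oppr0.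
by rewrite [a (- _)]linearN scaleNr !scalerN !opprK addrC.
Qed.

Lemma sympl_embV_coord x v :
  sympl x (embV v) = v.1 * sympl x u + v.2 * sympl x (cpx u).
Proof. by rewrite hom_ofE linearDr /= !linearZr_LR. Qed.

Lemma coordV_embV v : coordV (embV v) = v.
Proof.
rewrite hom_ofE cpx_embV !sympl_embV_coord zu1 zJu0 hom_ofE /=.
by rewrite !mulr0 !mulr1 !addr0 opprK; case: v.
Qed.

Lemma sympl_embV v w : sympl (embV v) (embV w) = 0.
Proof.
rewrite sympl_embV_coord [sympl _ u]symplC [sympl _ (cpx u)]symplC.
rewrite !sympl_embV_coord.
by rewrite !sympl_cpxl cpxK linearNr /= !symplxx sympl_cpxx; ring.
Qed.

Lemma coordV_embD a : coordV (embD a) = 0.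
Proof.
have zd b : sympl z (embD b) = 0.
  rewrite hom_ofE linearBr /= !linearZr_LR /= symplxx sympl_cpxx.
  by rewrite !mulr0 subr0.
by rewrite hom_ofE cpx_embD !zd oppr0.
Qed.

Lemma coordD_embD a : coordD (embD a) = a.
Proof. by apply/lfunP=> v; rewrite coordDE sympl_embD coordV_embV. Qed.

Lemma coordD_embV v : coordD (embV v) = 0.
Proof. by apply/lfunP=> w; rewrite coordDE sympl_embV lfunE. Qed.

Lemma coordV_cpx x : coordV (cpx x) = rot (coordV x).
Proof. by rewrite !hom_ofE /= cpxK linearNr /= !opprK. Qed.

Lemma coordD_cpx x : coordD (cpx x) = (coordD x \o rot)%VF.
Proof. by apply/lfunP=> v; rewrite comp_lfunE !coordDE sympl_cpxl cpx_embV. Qed.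

Lemma lie_embD a x : lie (embD a) x = 0.
Proof.
rewrite hom_ofE linearBl !linearZl_LR /= z_central abelian_central_cpx //.
by rewrite !scaler0 subr0.
Qed.

(** By closedness of [sympl], a central vector is orthogonal to all brackets;
    this applies to [z] and to [Jz]. *)
Lemma coordV_lie x y : coordV (lie x y) = 0.
Proof.
suff lie0 c : (forall x, lie c x = 0) -> sympl c (lie x y) = 0.
  rewrite hom_ofE lie0 // -sympl_cpxl lie0 ?oppr0 //.
  exact: abelian_central_cpx.
move=> c0; rewrite symplC; have := sympl_closed x y c.
by rewrite c0 (lieC y) c0 oppr0 !linear0l !addr0 => ->; rewrite oppr0.
Qed.

(** The symplectic orthogonal of the sum of the two complex lines, a complement
    of that sum on which [sympl] stays non-degenerate. *)
Definition core : {vspace g} := (lker coordV :&: lker coordD)%VS.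
Definition core_proj : 'End(g) := (\1 - (embV \o coordV) - (embD \o coordD))%VF.

Lemma coreP x : reflect (coordV x = 0 /\ coordD x = 0) (x \in core).
Proof. by rewrite memv_cap !memv_ker; apply: (iffP andP) => -[/eqP? /eqP?]. Qed.

Lemma core_projE x : core_proj x = x - embV (coordV x) - embD (coordD x).
Proof. by rewrite !(add_lfunE, opp_lfunE) id_lfunE !comp_lfunE. Qed.

Lemma core_proj_core x : core_proj x \in core.
Proof.
apply/coreP; rewrite core_projE !linearB /= coordV_embV coordD_embD.
by rewrite coordV_embD coordD_embV subrr !subr0 subrr.
Qed.

Lemma core_proj_id x : x \in core -> core_proj x = x.
Proof.
case/coreP=> v0 d0.
by rewrite core_projE v0 d0 [embV 0]linear0 [embD 0]linear0 !subr0.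
Qed.

Lemma core_proj_embV v : core_proj (embV v) = 0.
Proof.
by rewrite core_projE coordV_embV coordD_embV [embD 0]linear0 subrr subr0.
Qed.

Lemma core_proj_embD a : core_proj (embD a) = 0.
Proof.
by rewrite core_projE coordV_embD coordD_embD [embV 0]linear0 subr0 subrr.
Qed.

Lemma core_proj_cpx x : core_proj (cpx x) = cpx (core_proj x).
Proof.
by rewrite !core_projE !linearB /= cpx_embV cpx_embD coordV_cpx coordD_cpx.
Qed.

Lemma decomposition x :
  x = embV (coordV x) + core_proj x + embD (coordD x).
Proof. by rewrite core_projE -addrA subrK subrKC. Qed.

(** The projection is the [sympl]-orthogonal one. *)
Lemma sympl_core_proj x y : y \in core -> sympl (core_proj x) y = sympl x y.
Proof.
case/coreP=> v0 d0; rewrite core_projE !linearBl /= sympl_embD v0 linear0 subr0.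
by rewrite (symplC (embV _)) -coordDE d0 lfunE /= oppr0 subr0.
Qed.

(** Projecting a bracket to [core] only changes it by a central vector, so the
    projected bracket iterates like the original one.  The Jacobi identity for
    the reduction is a consequence. *)
Lemma lie_core_projr x y t : lie x (core_proj (lie y t)) = lie x (lie y t).
Proof.
rewrite core_projE coordV_lie [embV 0]linear0 subr0 linearBr /=.
by rewrite (lieC x (embD _)) lie_embD oppr0 subr0.
Qed.

(** * The symplectic reduction *)

Definition reduction_data : cs_data R :=
  @CSData R (subvs_of core)
    (fun x y : subvs_of core =>
       vsproj core (core_proj (lie (vsval x) (vsval y))))
    (fun x : subvs_of core => vsproj core (cpx (vsval x)))
    (fun x y : subvs_of core => sympl (vsval x) (vsval y)).

Lemma reduction_val_inj (x y : reduction_data) : vsval x = vsval y -> x = y.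
Proof. exact: val_inj. Qed.

Lemma val_comb c (x y : reduction_data) :
  vsval (c *: x + y) = c *: vsval x + vsval y.
Proof. by []. Qed.

Lemma val_add (x y : reduction_data) : vsval (x + y) = vsval x + vsval y.
Proof. by []. Qed.

Lemma val_opp (x : reduction_data) : vsval (- x) = - vsval x.
Proof. by []. Qed.

Lemma val_lie (x y : reduction_data) :
  vsval (lie x y) = core_proj (lie (vsval x) (vsval y)).
Proof. exact/vsprojK/core_proj_core. Qed.

Lemma val_cpx (x : reduction_data) : vsval (cpx x) = cpx (vsval x).
Proof.
apply: vsprojK; rewrite -(core_proj_id (subvsP x)) -core_proj_cpx.
exact: core_proj_core.
Qed.

Lemma val_sympl (x y : reduction_data) : sympl x y = sympl (vsval x) (vsval y).
Proof. by []. Qed.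

Lemma reduction_abelian : abelian_cpx reduction_data.
Proof.
by move=> x y; apply: reduction_val_inj; rewrite !val_lie !val_cpx -abelian_g.
Qed.

Lemma reductionP : is_complex_symplectic reduction_data.
Proof.
split.
- split=> [x c y w|x c y w|x|x y w]; apply: reduction_val_inj.
  + by rewrite val_comb !val_lie val_comb linearPr linearP.
  + by rewrite val_comb !val_lie val_comb linearPl linearP.
  + by rewrite val_lie liexx linear0.
  + rewrite !val_add !val_lie !lie_core_projr -!linearD /=.
    by rewrite jacobi linear0.
- split=> [c x y|x|x y]; apply: reduction_val_inj.
  + by rewrite val_comb !val_cpx linearP.
  + by rewrite !val_cpx cpxK.
  + rewrite /nijenhuis val_add val_opp !val_add !(val_cpx, val_lie).
    rewrite -!core_proj_cpx -!linearD -linearB /=.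
    have := abelian_nijenhuis (vsval x) (vsval y) abelian_g.
    by rewrite /nijenhuis => ->; rewrite linear0.
- split=> [x c y w|x c y w|x|x y w|x x0].
  + by rewrite /= linearPr.
  + by rewrite /= linearPl.
  + exact: symplxx.
  + rewrite !val_sympl !val_lie !sympl_core_proj ?subvsP //.
    exact: sympl_closed.
  + apply/reduction_val_inj/sympl_nondeg => y.
    rewrite symplC -sympl_core_proj ?subvsP // -(vsprojK (core_proj_core y)).
    by rewrite symplC opprK -val_sympl x0.
- by move=> x y; rewrite !val_sympl !val_cpx sympl_cpxl.
Qed.

Definition reduction : cs_lie R := CSLie reductionP.

Fact incl_linear : linear (fun x : reduction => vsval x).
Proof. exact: val_comb. Qed.
Definition incl : 'Hom(reduction, g) := hom_of incl_linear.

Lemma inclE (x : reduction) : incl x = vsval x.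
Proof. exact: hom_ofE. Qed.

(** The lower central series of the reduction is contained in the image of that
    of [g] modulo the central summand, and [core] meets the central summand
    trivially. *)
Lemma reduction_nilpotent : nilpotent_lie g -> nilpotent_lie reduction.
Proof.
case=> k gk0; exists k.
suff sub i : (lower_central reduction i <=
    incl @^-1: (lower_central g i + limg embD))%VS.
  apply/eqP; rewrite -subv0; apply: subv_trans (sub k) _.
  apply/subvP=> x; rewrite -memv_preim gk0 add0v inclE => /memv_imgP[a _ /= xa].
  rewrite memv0; apply/eqP/val_inj.
  by rewrite /= -(core_proj_id (subvsP x)) xa core_proj_embD.
elim: i => [|i IH].
  apply/subvP=> x _; rewrite -memv_preim.
  by apply: subvP (memvf _); exact: addvSl.
apply/(lie_prod_subvP _ _ _ (lie_bracket _)) => x y _ /(subvP IH).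
rewrite -!memv_preim !inclE.
move=> /memv_addP[y' y'_i [w /memv_imgP[a _ ->]] y_eq].
rewrite val_lie core_projE coordV_lie [embV 0]linear0 subr0.
apply: memvB; last by apply: subvP (memv_img _ (memvf _)); exact: addvSr.
rewrite y_eq linearDr /= (lieC _ (embD a)) lie_embD oppr0 addr0.
by apply: subvP (lie_lower_central _ y'_i); exact: addvSl.
Qed.

(** [u] is not orthogonal to [z], so [core] is a proper subspace. *)
Lemma reduction_dim : (\dim {:reduction} < \dim {:g})%N.
Proof.
have -> : \dim {:reduction} = \dim core by rewrite dimvf.
rewrite ltn_neqAle dimvS ?subvf // andbT; apply/eqP=> dim_eq.
have core_full : core = fullv.
  by apply/eqP; rewrite eqEdim subvf dim_eq leqnn.
have : u \in core by rewrite core_full memvf.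
by case/coreP; rewrite hom_ofE zu1 => -[/eqP]; rewrite oner_eq0.
Qed.

(** * Reconstruction by oxidation *)

Fact proj_linear : linear (fun x => vsproj core (core_proj x) : reduction).
Proof. by move=> c x y; rewrite !linearP. Qed.
Definition proj : 'Hom(g, reduction) := hom_of proj_linear.

Lemma val_proj x : vsval (proj x) = core_proj x.
Proof. by rewrite hom_ofE vsprojK ?core_proj_core. Qed.

Fact assemble_linear :
  linear (fun t : oxidation_space plane reduction =>
    embV t.1.1 + vsval t.1.2 + embD t.2).
Proof.
move=> c [[v x] a] [[w y] b] /=; rewrite !linearP /= !scalerDr.
by rewrite [RHS]addrACA [X in _ = X + _]addrACA.
Qed.

Definition assemble : 'Hom(oxidation_space plane reduction, g) :=
  hom_of assemble_linear.

Lemma assembleE v (x : reduction) a :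
  assemble (v, x, a) = embV v + vsval x + embD a.
Proof. exact: hom_ofE. Qed.

Definition red_nu := lie_hom embV embV proj.
Definition red_tau := lie_hom embV embV coordD.
Definition red_f := lie_hom embV incl proj.
Definition red_g := lie_hom embV incl coordD.
Definition red_beta := lie_hom incl incl coordD.

Lemma coordV_assemble v (x : reduction) a : coordV (assemble (v, x, a)) = v.
Proof.
have [x0 _] := coreP _ (subvsP x).
by rewrite assembleE !linearD /= coordV_embV x0 coordV_embD !addr0.
Qed.

Lemma coordD_assemble v (x : reduction) a : coordD (assemble (v, x, a)) = a.
Proof.
have [_ x0] := coreP _ (subvsP x).
by rewrite assembleE !linearD /= coordD_embV x0 coordD_embD !add0r.
Qed.

Lemma proj_assemble v (x : reduction) a : proj (assemble (v, x, a)) = x.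
Proof.
apply: reduction_val_inj; rewrite val_proj assembleE !linearD /=.
by rewrite core_proj_embV core_proj_embD core_proj_id ?subvsP // addr0 add0r.
Qed.

Lemma assembleK x : assemble (coordV x, proj x, coordD x) = x.
Proof. by rewrite assembleE val_proj -decomposition. Qed.

Lemma assemble_bij : bijective assemble.
Proof.
exists (fun x => (coordV x, proj x, coordD x)) => [[[v x] a]|x].
  by rewrite coordV_assemble proj_assemble coordD_assemble.
exact: assembleK.
Qed.

(** The central components [a] and [b] do not contribute to the bracket. *)
Lemma lie_assemble v (x : reduction) a w (y : reduction) b :
  lie (assemble (v, x, a)) (assemble (w, y, b)) =
  lie (embV v) (embV w) + lie (embV v) (incl y) - lie (embV w) (incl x)
    + lie (incl x) (incl y).
Proof.
rewrite !assembleE !inclE linearDr /= (lieC _ (embD b)) lie_embD oppr0 addr0.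
rewrite linearDl /= lie_embD addr0 linearDl !linearDr /=.
by rewrite (lieC (vsval x) (embV w)) addrA.
Qed.

Lemma proj_lie (x y : reduction) : proj (lie (incl x) (incl y)) = lie x y.
Proof. by rewrite !inclE hom_ofE. Qed.

Lemma proj_lie_assemble v (x : reduction) a w (y : reduction) b :
  proj (lie (assemble (v, x, a)) (assemble (w, y, b))) =
  red_nu v w + red_f v y - red_f w x + lie x y.
Proof.
by rewrite lie_assemble linearD linearB linearD /= proj_lie !lie_homE.
Qed.

Lemma coordD_lie_assemble v (x : reduction) a w (y : reduction) b :
  coordD (lie (assemble (v, x, a)) (assemble (w, y, b))) =
  red_tau v w + red_g v y - red_g w x + red_beta x y.
Proof. by rewrite lie_assemble linearD linearB linearD /= !lie_homE. Qed.

(** Both sides are compared component by component: the [V]-components vanish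
    by [coordV_lie], and the other two define the tensors. *)
Lemma assemble_lie (s t : oxidation_space plane reduction) :
  assemble (oxidation_lie red_nu red_tau red_f red_g red_beta s t) =
  lie (assemble s) (assemble t).
Proof.
case: s => [[v x] a]; case: t => [[w y] b]; apply: etrans (assembleK _).
by rewrite coordV_lie proj_lie_assemble coordD_lie_assemble.
Qed.

Lemma assemble_cpx (t : oxidation_space plane reduction) :
  assemble (oxidation_cpx rot t) = cpx (assemble t).
Proof.
case: t => [[v x] a].
by rewrite !assembleE val_cpx !linearD /= cpx_embV cpx_embD.
Qed.

Lemma assemble_sympl (s t : oxidation_space plane reduction) :
  oxidation_sympl s t = sympl (assemble s) (assemble t).
Proof.
case: s t => [[v x] a] [[w y] b]; rewrite /oxidation_sympl.
have [x0 x1] := coreP _ (subvsP x); have [y0 y1] := coreP _ (subvsP y).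
have dual s c : sympl s (embD c) = - c (coordV s).
  by rewrite symplC sympl_embD.
have perp s k : coordD s = 0 -> sympl s (embV k) = 0.
  by move=> s0; rewrite -coordDE s0 lfunE.
rewrite val_sympl !assembleE !linearDl !linearDr /= !sympl_embD !dual.
rewrite sympl_embV (symplC (embV v)) !perp // !coordV_embV x0 y0.
rewrite !coordV_embD !linear0 !(add0r, addr0).
by rewrite [RHS]addrC addrA.
Qed.

Lemma reduction_is_oxidation : is_oxidation g reduction.
Proof.
exists plane, rot, red_nu, red_tau, red_f, red_g, red_beta; split.
- by rewrite dimvf.
- by move=> v; rewrite !hom_ofE; case: v.
- by split=> v; rewrite lie_homE liexx linear0.
exists assemble; split; [exact: assemble_bij | exact: assemble_lie | |].
  exact: assemble_cpx.
exact: assemble_sympl.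
Qed.

End Reduction.

(** * Induction on the dimension *)

Theorem theorem6p4 (R : realType) (g : cs_lie R)
    (g_nilpotent : nilpotent_lie g) (J_abelian : abelian_cpx g) :
  iterated_oxidation_from_trivial g.
Proof.
have [n] := ubnP (\dim {:g}).
elim: n g g_nilpotent J_abelian => // n IH g g_nil J_ab g_dim.
have [g0|g_neq0] := eqVneq (\dim {:g}) 0%N.
  by exists 0%N, (fun=> g).
have [z z_neq0 z_central] := nilpotent_center g_nil g_neq0.
have [u [zu1 zJu0]] := exists_dual_vector z_neq0.
pose gbar := reduction J_ab z_central zu1 zJu0.
have [] := IH gbar.
- exact: reduction_nilpotent.
- exact: reduction_abelian.
- by rewrite -ltnS (leq_trans _ g_dim) // ltnS reduction_dim.
move=> m [s [s0 s_ox sm]].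
exists m.+1, (fun i => if (i <= m)%N then s i else g).
split=> //= [i|]; last by rewrite ltnn.
rewrite ltnS => im; rewrite im; case: ltnP => [/s_ox //|mi].
have -> : i = m by apply/eqP; rewrite eqn_leq im mi.
by rewrite sm; exact: reduction_is_oxidation.
Qed.
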